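(* For every integer $n > 7$, let $T_1$ be the starlike tree with three pendent paths of lengths $n-5$, $2$ and $2$, and let $T_2$ be the tree obtained from a path $v_0 v_1 \cdots v_{n-3}$ by attaching one pendent vertex to $v_1$ and one pendent vertex to $v_{n-4}$. Then $T_1$ and $T_2$ are trees of order $n$ with $T_2 \prec^1 T_1$ and $T_1 \prec^2 T_2$.
   Context: For a simple graph $G$ on $n$ vertices with Laplacian matrix $L(G) = D(G) - A(G)$, the Laplacian coefficients $c_0(G), \ldots, c_n(G)$ are defined by $\det(\lambda I_n - L(G)) = \sum_{k=0}^n (-1)^k c_k(G) \lambda^{n-k}$. For two trees $T, T'$ of order $n$, not having all Laplacian coefficients equal, let $r$ (respectively $s$) be the smallest (respectively largest) integer such that $c_r(T) \neq c_r(T')$ (respectively $c_s(T) \neq c_s(T')$). Write $T \prec^1 T'$ if $c_r(T) < c_r(T')$, and $T \prec^2 T'$ if $c_s(T) < c_s(T')$. A starlike tree with pendent paths of lengths $n_1, n_2, n_3$ consists of a root vertex with three paths of these lengths (numbers of edges) attached at it; it has $n_1+n_2+n_3+1$ vertices. *)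

(* Defs.v *)
From HB Require Import structures.
From mathcomp Require Import all_boot all_order all_algebra.

Set Implicit Arguments.
Unset Strict Implicit.
Unset Printing Implicit Defensive.

Import GRing.Theory.
Local Open Scope ring_scope.

Record sgraph := SGraph {
  vertex :> finType;
  adj : rel vertex;
  adj_sym : symmetric adj;
  adj_irr : irreflexive adj
}.

Definition gorder (G : sgraph) : nat := #|G|.

Definition connected (G : sgraph) : Prop :=
  (0 < gorder G)%N /\ forall x y : G, connect (@adj G) x y.

(* [ucycle] also accepts the closed walk x, y, x along a single edge, as a
   vertex sequence of size 2; genuine cycles have at least 3 vertices. *)
Definition acyclic (G : sgraph) : Prop :=
  forall c : seq G, (2 < size c)%N -> ~ ucycle (@adj G) c.

Definition is_tree (G : sgraph) : Prop := connected G /\ acyclic G.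

Definition degree (G : sgraph) (v : G) : nat := #|[set w | adj v w]|.

(* Rows and columns are indexed through the enumeration of the vertices. *)
Definition adjacency_mx (G : sgraph) : 'M[int]_(gorder G) :=
  \matrix_(i, j) (adj (enum_val i : G) (enum_val j : G))%:R.

Definition degree_mx (G : sgraph) : 'M[int]_(gorder G) :=
  diag_mx (\row_i (degree (enum_val i : G))%:R).

Definition laplacian (G : sgraph) : 'M[int]_(gorder G) :=
  degree_mx G - adjacency_mx G.

(* Meaningful for k <= gorder G only; [char_poly_laplacian] below is the
   defining identity of these coefficients. *)
Definition lap_coef (G : sgraph) (k : nat) : int :=
  (-1) ^+ k * (char_poly (laplacian G))`_(gorder G - k).

Lemma char_poly_laplacian (G : sgraph) :
  \det ('X%:M - map_mx polyC (laplacian G)) =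
    \sum_(k < (gorder G).+1) ((-1) ^+ k * lap_coef G k) *: 'X^(gorder G - k).
Proof.
rewrite -[LHS]/(char_poly (laplacian G)) -[LHS]coefK size_char_poly poly_def.
rewrite (reindex_inj rev_ord_inj) /=; apply: eq_bigr => k _.
by rewrite subSS /lap_coef mulrA -exprMn mulrNN mulr1 expr1n mul1r.
Qed.

(* The relations below are used for graphs T, T' of the same order. *)
Definition lap_differ (T T' : sgraph) (k : nat) : Prop :=
  (k <= gorder T)%N /\ lap_coef T k <> lap_coef T' k.

Definition prec1 (T T' : sgraph) : Prop :=
  exists r : nat,
    [/\ lap_differ T T' r,
        forall k : nat, lap_differ T T' k -> (r <= k)%N
      & lap_coef T r < lap_coef T' r].

Definition prec2 (T T' : sgraph) : Prop :=
  exists s : nat,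
    [/\ lap_differ T T' s,
        forall k : nat, lap_differ T T' k -> (k <= s)%N
      & lap_coef T s < lap_coef T' s].

Definition sym_closure (V : Type) (e : rel V) : rel V :=
  fun x y => e x y || e y x.

Lemma sym_closure_sym (V : Type) (e : rel V) : symmetric (sym_closure e).
Proof. by move=> x y; rewrite /sym_closure orbC. Qed.

Lemma sym_closure_irr (V : Type) (e : rel V) :
  irreflexive e -> irreflexive (sym_closure e).
Proof. by move=> e_irr x; rewrite /sym_closure orbb. Qed.

(* [None] is the root; on the arm with n_i edges the vertex with index k is at
   distance k + 1 from the root. Edges are oriented away from the root. *)
Definition starlike_arc (n1 n2 n3 : nat) :
    rel (option ('I_n1 + 'I_n2 + 'I_n3)) :=
  fun x y => match x, y with
  | None, Some (inl (inl j)) => j == 0%N :> nat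
  | None, Some (inl (inr j)) => j == 0%N :> nat
  | None, Some (inr j) => j == 0%N :> nat
  | Some (inl (inl i)), Some (inl (inl j)) => j == i.+1 :> nat
  | Some (inl (inr i)), Some (inl (inr j)) => j == i.+1 :> nat
  | Some (inr i), Some (inr j) => j == i.+1 :> nat
  | _, _ => false
  end.

Lemma starlike_arc_irr (n1 n2 n3 : nat) : irreflexive (@starlike_arc n1 n2 n3).
Proof. by move=> [[[i|i]|i]|] //=; rewrite ltn_eqF. Qed.

Definition starlike (n1 n2 n3 : nat) : sgraph :=
  SGraph (sym_closure_sym (@starlike_arc n1 n2 n3))
         (sym_closure_irr (@starlike_arc_irr n1 n2 n3)).

(* The path v_0 ... v_(m-1), where [inl i] is v_i, with one pendent vertex
   [inr false] attached to v_p and another one [inr true] attached to v_q. *)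
Definition pendent2_arc (m p q : nat) : rel ('I_m + bool) :=
  fun x y => match x, y with
  | inl i, inl j => j == i.+1 :> nat
  | inl i, inr b => i == (if b then q else p) :> nat
  | _, _ => false
  end.

Lemma pendent2_arc_irr (m p q : nat) : irreflexive (@pendent2_arc m p q).
Proof. by move=> [i|b] //=; rewrite ltn_eqF. Qed.

Definition path_pendent2 (m p q : nat) : sgraph :=
  SGraph (sym_closure_sym (@pendent2_arc m p q))
         (sym_closure_irr (@pendent2_arc_irr m p q)).

(* Main.v *)
Require Import Defs.
From mathcomp Require Import all_boot all_order all_algebra.
From mathcomp Require Import all_fingroup.
From mathcomp Require Import zify ring.

Set Implicit Arguments.
Unset Strict Implicit.
Unset Printing Implicit Defensive.

Import Order.TTheory GRing.Theory Num.Theory.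
Local Open Scope ring_scope.

(** The two trees are compared through three coefficients at each end; the
    relations are decided by the indices 2 and n - 2.

    At the beginning, c_0 = 1 and c_1 is the sum of the degrees, that is
    2(n - 1) for a tree, whereas the principal minors of order two give
    2 c_2 = (sum d)^2 - sum d^2 - sum d ([lap_coef2]). For trees of the same
    order, c_2 is thus determined by the sum of (d - 1)(d - 2), to which only
    the branching vertices contribute: T_1 has one of degree 3 and T_2 has two,
    so that c_2(T_1) = c_2(T_2) + 1.

    At the end, root the tree, direct its edges away from the root, and let S be
    the matrix of the relation: y descends from x. It is the inverse of 1 - N,
    with N the matrix of the arcs, and (1 - N)(1 - N)^T is the Laplacian matrix
    L plus the elementary matrix E of the root. Hence S L S^T = 1 - E with S
    unimodular, and the characteristic polynomial of L is
    det (X S S^T - 1 + E) ([char_poly_rooted]). Its lowest coefficients are read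
    off from the minors of S S^T: up to sign they are 0, n and the sum over the
    vertices x of s(n - s), with s the number of descendants of x, itself
    included ([rooted_lap_coefn2]); this sum is the Wiener index, with x standing for the
    edge that joins it to its parent. So c_n and c_(n-1) agree, and explicit
    summation gives c_(n-2)(T_2) - c_(n-2)(T_1) = 2n - 14, which is positive
    exactly when n > 7. *)

(** * Low order coefficients of a determinant *)

Definition mix_rows (R : nzRingType) n (S : {set 'I_n}) (A B : 'M[R]_n) :=
  \matrix_(i, j) (if i \in S then B i j else A i j).

(** The determinant is additive in each row, so the coefficient of degree [m]
    collects the choices of [m] rows to be taken from [B]. *)
Lemma coef_det_pencil (R : comNzRingType) n (A B : 'M[R]_n) m :
  (\det (map_mx polyC A + 'X *: map_mx polyC B))`_m =
  \sum_(S : {set 'I_n} | #|S| == m) \det (mix_rows S A B).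
Proof.
transitivity (\sum_(S : {set 'I_n})
    ((\det (mix_rows S A B))%:P * 'X^#|S|)`_m).
  rewrite -coef_sum; congr ((polyseq _)`_m).
  transitivity (\sum_(s : 'S_n) \sum_(S : {set 'I_n})
      ((-1) ^+ s * \prod_i mix_rows S A B i (s i))%:P * 'X^#|S|).
    apply: eq_bigr => s _.
    under eq_bigr => i _ do rewrite !mxE addrC.
    rewrite bigA_distr mulr_sumr; apply: eq_bigr => S _.
    rewrite polyCM rmorphXn rmorphN rmorph1 -mulrA; congr (_ * _).
    rewrite rmorph_prod -prodr_const [X in _ * X]big_mkcond -big_split /=.
    apply: eq_bigr => i _; rewrite !mxE.
    by case: ifP => _; rewrite ?mulr1 // mulrC.
  rewrite exchange_big /=; apply: eq_bigr => S _.
  by rewrite -mulr_suml -rmorph_sum.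
rewrite [RHS]big_mkcond /=; apply: eq_bigr => S _.
by rewrite coefCM coefXn eq_sym; case: eqP => _; rewrite ?mulr1 ?mulr0.
Qed.

(** Only permutations that fix the diagonal rows survive in the Leibniz
    formula. *)
Lemma det_mix_diag (R : comNzRingType) n (S : {set 'I_n}) (d : 'rV[R]_n)
    (M : 'M[R]_n) :
  \det (mix_rows S (diag_mx d) M) =
  (\prod_(k in ~: S) d 0 k) *
  \sum_(s : 'S_n | perm_on S s) (-1) ^+ s * \prod_(k in S) M k (s k).
Proof.
rewrite /determinant mulr_sumr [RHS]big_mkcond /=; apply: eq_bigr => s _.
case: ifPn => [sS | /subsetPn[k]].
  rewrite mulrCA; congr (_ * _); rewrite (bigID [in S]) /= mulrC.
  congr (_ * _); last by apply: eq_bigr => k kS; rewrite mxE kS.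
  apply: eq_big => [k | k kS]; first by rewrite inE.
  by rewrite !mxE (negPf kS) (out_perm sS kS) eqxx.
rewrite inE => sk kS; rewrite (bigD1 k) //= !mxE (negPf kS).
by rewrite eq_sym (negPf sk) mulr0n mul0r mulr0.
Qed.

Lemma det_mix_diag0 (R : comNzRingType) n (d : 'rV[R]_n) (M : 'M[R]_n) :
  \det (mix_rows set0 (diag_mx d) M) = \prod_k d 0 k.
Proof.
rewrite -det_diag; congr (\det _); apply/matrixP => k l.
by rewrite !mxE in_set0.
Qed.

Lemma det_mix_diag1 (R : comNzRingType) n (d : 'rV[R]_n) (M : 'M[R]_n) i :
  \det (mix_rows [set i] (diag_mx d) M) = (\prod_(k | k != i) d 0 k) * M i i.
Proof.
rewrite det_mix_diag; congr (_ * _); first by apply: eq_bigl => k; rewrite !inE.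
rewrite (big_pred1 1%g) => [|s /=].
  by rewrite odd_perm1 mul1r big_set1 perm1.
apply/idP/eqP => [si | ->]; last exact: perm_on1.
apply/permP => k; rewrite perm1; case: (eqVneq k i) => [->|ki].
  by have := perm_closed i si; rewrite !inE eqxx => /eqP.
by apply: (out_perm si); rewrite inE.
Qed.

Lemma det_mix_diag2 (R : comNzRingType) n (d : 'rV[R]_n) (M : 'M[R]_n) i j :
  i != j ->
  \det (mix_rows [set i; j] (diag_mx d) M) =
  (\prod_(k in ~: [set i; j]) d 0 k) * (M i i * M j j - M i j * M j i).
Proof.
move=> ij; rewrite det_mix_diag; congr (_ * _).
have prod2 (F : 'I_n -> R) : \prod_(k in [set i; j]) F k = F i * F j.
  by rewrite big_setU1 ?inE //= big_set1.
rewrite (bigD1 1%g) /= ?perm_on1 // (bigD1 (tperm i j)) /=; last first.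
  rewrite tperm_on /=; apply: contraNneq ij => /permP/(_ i).
  by rewrite tpermL perm1 => ->.
rewrite [X in _ + (_ + X)]big1 ?addr0 => [|s /andP[/andP[sS s1] st]].
  by rewrite !prod2 odd_perm1 odd_tperm ij !perm1 tpermL tpermR mul1r mulN1r.
have si : s i \in [set i; j] by rewrite (perm_closed _ sS) !inE eqxx.
have sj : s j \in [set i; j] by rewrite (perm_closed _ sS) !inE eqxx orbT.
have out k : k != i -> k != j -> s k = k.
  by move=> ki kj; apply: (out_perm sS); rewrite !inE negb_or ki kj.
have sij : s i != s j by rewrite (inj_eq perm_inj).
case/set2P: si sij => si; case/set2P: sj => sj; rewrite si sj ?eqxx //= => _.
- case/eqP: s1; apply/permP => k; rewrite perm1.
  by case: (eqVneq k i) => [->//|ki]; case: (eqVneq k j) => [->//|kj]; apply: out.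
- case/eqP: st; apply/permP => k.
  by case: tpermP => [->//|->//|/eqP ki /eqP kj]; apply: out.
Qed.

(** Each pair of indices is the underlying set of two ordered pairs. *)
Lemma sum_pairs (R : nmodType) (I : finType) (F : {set I} -> R) :
  (\sum_(S : {set I} | #|S| == 2) F S) *+ 2 =
  \sum_i \sum_(j | j != i) F [set i; j].
Proof.
rewrite pair_big_dep /= -sumrMnl.
rewrite (partition_big (fun p => [set p.1; p.2]) (fun S => #|S| == 2)) /=; last first.
  by case=> i j /= ji; rewrite cards2 (eq_sym i) ji.
apply: eq_bigr => S /cards2P[i [j [ij ->]]].
rewrite (bigD1 (i, j)) /=; last by rewrite (eq_sym j) ij eqxx.
rewrite (bigD1 (j, i)) /=; last first.
  by rewrite ij setUC eqxx xpair_eqE negb_and (eq_sym j) ij.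
rewrite big1 ?addr0 => [|[k l] /= /andP[/andP[/andP[lk /eqP S_kl] ne1] ne2]].
  by rewrite [[set j; i]]setUC mulr2n.
have := set21 k l; have := set22 k l; rewrite S_kl !inE.
by do 2![case/orP=> /eqP ?]; subst; rewrite eqxx in lk ne1 ne2.
Qed.

(** The second elementary symmetric function of the eigenvalues is the sum of
    the principal minors of order two. *)
Lemma char_poly_coef2 (R : comNzRingType) n (A : 'M[R]_n) :
  (1 < n)%N ->
  (char_poly A)`_(n - 2) *+ 2 =
  \sum_i \sum_(j | j != i) (A i i * A j j - A i j * A j i).
Proof.
move=> n_gt1.
have -> : char_poly A = \det (map_mx polyC (- A) + 'X *: map_mx polyC 1%:M).
  congr (\det _); apply/matrixP => i j.
  by rewrite !mxE addrC -rmorphN; case: (i == j); rewrite ?mulr1 ?mulr0.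
(* Choosing the n - 2 rows of the identity amounts to choosing the two others. *)
rewrite coef_det_pencil (reindex_inj (@setC_inj _)) /=.
rewrite (eq_bigl (fun S : {set 'I_n} => #|S| == 2)) => [|S]; last first.
  have := cardsC S; rewrite card_ord => cardS.
  by rewrite -(eqn_add2l #|S|) cardS -{1}(subnKC n_gt1) eqn_add2r eq_sym.
rewrite (sum_pairs (fun S => \det (mix_rows (~: S) (- A) 1%:M))).
apply: eq_bigr => i _; apply: eq_bigr => j ji.
have -> : mix_rows (~: [set i; j]) (- A) 1%:M =
          mix_rows [set i; j] (diag_mx (const_mx 1)) (- A).
  by rewrite diag_const_mx; apply/matrixP => k l; rewrite !mxE in_setC; case: (k \in _).
rewrite det_mix_diag2 1?eq_sym // big1 => [|k _]; last by rewrite mxE.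
by rewrite mul1r !mxE !mulrNN.
Qed.

(** * First Laplacian coefficients of a graph *)

Lemma sum_vertices (R : nmodType) (G : sgraph) (F : G -> R) :
  \sum_(i < gorder G) F (enum_val i) = \sum_v F v.
Proof. exact/esym/big_enum_val. Qed.

Lemma laplacianE (G : sgraph) i j :
  laplacian G i j =
  (degree (enum_val i))%:R *+ (i == j) - (adj (enum_val i) (enum_val j))%:R.
Proof. by rewrite !mxE. Qed.

Lemma lap_coef0 (G : sgraph) : lap_coef G 0 = 1.
Proof.
rewrite /lap_coef expr0 mul1r subn0.
have /monicP := char_poly_monic (laplacian G).
by rewrite /lead_coef size_char_poly.
Qed.

Lemma lap_coef1 (G : sgraph) :
  (0 < gorder G)%N -> lap_coef G 1 = \sum_(v : G) (degree v)%:R.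
Proof.
move=> G_gt0; rewrite /lap_coef subn1 char_poly_trace // mulrNN mul1r.
rewrite -sum_vertices; apply: eq_bigr => i _.
by rewrite laplacianE eqxx adj_irr subr0.
Qed.

Lemma sum_adj (G : sgraph) (v : G) :
  \sum_w (adj v w)%:R = (degree v)%:R :> int.
Proof.
rewrite /degree -sum1_card natr_sum [RHS]big_mkcond /=.
by apply: eq_bigr => w _; rewrite inE; case: (adj v w).
Qed.

Lemma lap_coef2 (G : sgraph) :
  (1 < gorder G)%N ->
  lap_coef G 2 *+ 2 = (\sum_(v : G) (degree v)%:R) ^+ 2
    - \sum_(v : G) (degree v)%:R ^+ 2 - \sum_(v : G) (degree v)%:R.
Proof.
move=> G_gt1; rewrite /lap_coef sqrrN expr1n mul1r char_poly_coef2 //.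
rewrite expr2 mulr_suml -!sumrB -sum_vertices; apply: eq_bigr => i _.
pose d (k : 'I_(gorder G)) := (degree (enum_val k : G))%:R : int.
transitivity (\sum_(j | j != i) (d i * d j - (adj (enum_val i) (enum_val j))%:R)).
  apply: eq_bigr => j ji; rewrite !laplacianE !adj_irr !eqxx !subr0.
  rewrite (eq_sym i) (negPf ji) !sub0r mulrNN (adj_sym (enum_val j)).
  by case: (adj _ _); rewrite ?mulr1 ?mulr0.
rewrite sumrB -mulr_sumr.
have -> : \sum_(j | j != i) d j = \sum_(v : G) (degree v)%:R - d i.
  by rewrite -sum_vertices [in RHS](bigD1 i) //= -/(d i) [RHS]addrC addKr.
have -> : \sum_(j | j != i) (adj (enum_val i) (enum_val j))%:R = d i.
  by rewrite /d -sum_adj -sum_vertices [RHS](bigD1 i) //= adj_irr add0r.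
by rewrite mulrBr -expr2.
Qed.

(** * Rooted trees *)

(** An orientation away from the root [r], in which every other vertex has
    exactly one parent. The function [h], which increases along the arcs, is the
    measure for inductions from the root and excludes directed cycles. *)
Record rooted_tree (G : sgraph) (e : rel G) (r : G) (h : G -> nat) : Prop :=
  RootedTree {
    rt_adj : @adj G =2 sym_closure e;
    rt_height : forall x y, e x y -> (h x < h y)%N;
    rt_parent_uniq : forall x x' y, e x y -> e x' y -> x = x';
    rt_root : forall x, ~~ e x r;
    rt_parent : forall y, y != r -> exists x, e x y
  }.

Section RootedTree.

Variables (G : sgraph) (e : rel G) (r : G) (h : G -> nat).
Hypothesis eT : rooted_tree e r h.

Let n := gorder G.

Lemma rooted_gorder_gt0 : (0 < gorder G)%N.
Proof. by apply/card_gt0P; exists r. Qed.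

Lemma connect_height x y : connect e x y -> (h x <= h y)%N.
Proof.
case/connectP => p; elim: p x => [|z p IHp] x /=; first by move=> _ ->.
by case/andP=> /(rt_height eT) xz /IHp zy /zy; apply/leq_trans/ltnW.
Qed.

Lemma root_connect x : connect e r x.
Proof.
have [k] := ubnP (h x); elim: k x => // k IHk x.
case: (eqVneq x r) => [->|/(rt_parent eT)[p px]]; first by rewrite connect0.
move=> hx; apply: connect_trans (connect1 px); apply: IHk.
exact: leq_trans (rt_height eT px) _.
Qed.

Lemma connect_parent x y p :
  e p y -> connect e x y = (x == y) || connect e x p.
Proof.
move=> py; apply/idP/orP => [|[/eqP->|xp]]; last 2 first.
- exact: connect0.
- exact: connect_trans xp (connect1 py).
case/connectP => q; case/lastP: q => [|q z] /=; first by move=> _ ->; left.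
rewrite rcons_path last_rcons => /andP[xq qz] yz; rewrite -yz in qz.
right; rewrite (rt_parent_uniq eT py qz).
by apply/connectP; exists q.
Qed.

Lemma rooted_connected : connected G.
Proof.
split=> [|x y]; first exact: rooted_gorder_gt0.
have sub : subrel (connect e) (connect (@adj G)).
  apply: connect_sub => u v uv; apply: connect1.
  by rewrite (rt_adj eT) /sym_closure uv.
have sym : connect_sym (@adj G).
  exact/sym_connect_sym/adj_sym.
by apply: connect_trans (sub _ _ (root_connect y)); rewrite sym sub ?root_connect.
Qed.

(** Both neighbours on a cycle of a highest vertex would be its parent. *)
Lemma rooted_acyclic : acyclic G.
Proof.
move=> c c_gt2 /andP[c_cycle c_uniq].
have [x0 x0c] : exists x0, x0 \in c.
  by case: c c_gt2 {c_cycle c_uniq} => // x c _; exists x; rewrite inE eqxx.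
have [x xc x_max] := arg_maxnP h x0c.
have [k c' rot_c] := rot_to xc.
have up y : y \in c -> adj y x -> e y x.
  move=> yc; rewrite (rt_adj eT) => /orP[//|/(rt_height eT)].
  by have /= := x_max y yc; rewrite leqNgt => /negPf->.
have mem_c y : y \in x :: c' -> y \in c by rewrite -rot_c mem_rot.
move: c_gt2 c_cycle c_uniq.
rewrite -(size_rot k) -(rot_cycle k) -(rot_uniq k) rot_c.
case: c' {rot_c} mem_c => [|y [|z p]] // mem_c _ /=.
rewrite rcons_path => /and4P[xy _ _ lx] /and3P[_ /negP yzp _].
have lastzp : last z p \in z :: p by exact: mem_last.
case: yzp; rewrite (rt_parent_uniq eT (_ : e y x) (_ : e (last z p) x)) //.
  by rewrite up ?mem_c ?inE ?eqxx ?orbT // adj_sym.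
by rewrite up ?mem_c // !inE -in_cons lastzp !orbT.
Qed.

Lemma rooted_is_tree : is_tree G.
Proof. by split; [exact: rooted_connected | exact: rooted_acyclic]. Qed.

Lemma sum_parents y (F : G -> int) :
  \sum_x (e x y)%:R * F x = if [pick x | e x y] is Some p then F p else 0.
Proof.
case: pickP => [p py | no_p]; last by rewrite big1 // => x _; rewrite no_p mul0r.
rewrite (bigD1 p) //= py mul1r big1 ?addr0 // => x xp.
case: (boolP (e x y)) => [exy|_]; last by rewrite mul0r.
by rewrite (rt_parent_uniq eT py exy) eqxx in xp.
Qed.

Lemma indegree y : \sum_x (e x y)%:R = (y != r)%:R :> int.
Proof.
transitivity (\sum_x (e x y)%:R * 1 : int).
  by apply: eq_bigr => x _; rewrite mulr1.
rewrite (sum_parents y (fun=> 1)); case: pickP => [p py | no_p].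
  by case: eqVneq py => // ->; rewrite (negPf (rt_root eT p)).
by case: eqVneq no_p => // /(rt_parent eT)[p py] /(_ p); rewrite py.
Qed.

Lemma rooted_adjE x y : (adj x y)%:R = (e x y)%:R + (e y x)%:R :> int.
Proof.
rewrite (rt_adj eT) /sym_closure; case exy: (e x y); case eyx: (e y x) => //.
by have := ltn_trans (rt_height eT exy) (rt_height eT eyx); rewrite ltnn.
Qed.

Lemma rooted_degree x :
  (degree x)%:R = \sum_y (e x y)%:R + (x != r)%:R :> int.
Proof.
rewrite -sum_adj -indegree -big_split /=.
by apply: eq_bigr => y _; rewrite rooted_adjE.
Qed.

Lemma sum_nonroot : \sum_(x : G) (x != r)%:R = n%:R - 1 :> int.
Proof.
rewrite (bigD1 r) //= eqxx add0r.
rewrite (eq_bigr (fun=> 1)) => [|x ->//].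
by rewrite sumr_const cardC1 -subn1 natrB ?rooted_gorder_gt0.
Qed.

Lemma sum_degree : \sum_(x : G) (degree x)%:R = (n%:R - 1) *+ 2 :> int.
Proof.
rewrite (eq_bigr _ (fun x _ => rooted_degree x)) big_split /= exchange_big /=.
by rewrite (eq_bigr _ (fun x _ => indegree x)) sum_nonroot mulr2n.
Qed.

Lemma rooted_lap_coef1 : lap_coef G 1 = (n%:R - 1) *+ 2.
Proof. by rewrite lap_coef1 ?sum_degree ?rooted_gorder_gt0. Qed.

(** The degree sum of a tree is known from its order. Writing the sum of squares
    in terms of (d - 1)(d - 2) makes vertices of degree 1 and 2 disappear. *)
Lemma rooted_lap_coef2 :
  (1 < n)%N ->
  lap_coef G 2 *+ 2 = ((n%:R - 1) *+ 2) ^+ 2 - (n%:R - 1) *+ 8 + n%:R *+ 2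
    - \sum_(x : G) ((degree x)%:R - 1) * ((degree x)%:R - 2).
Proof.
move=> n_gt1; rewrite lap_coef2 // sum_degree.
have -> : \sum_(x : G) (degree x)%:R ^+ 2 =
    \sum_(x : G) ((degree x)%:R - 1) * ((degree x)%:R - 2)
    + (\sum_(x : G) (degree x)%:R) *+ 3 - n%:R *+ 2 :> int.
  rewrite -[n%:R]sumr_const -!sumrMnl -big_split -sumrB /=.
  by apply: eq_bigr => x _; ring.
by rewrite sum_degree; ring.
Qed.

(** * Last Laplacian coefficients of a rooted tree *)

(** The vertices stand for their ranks in the enumeration, so that products are
    computed as sums over vertices. *)
Definition vertex_mx (F : G -> G -> int) : 'M[int]_n :=
  \matrix_(i, j) F (enum_val i) (enum_val j).

Lemma vertex_mxM F H :
  vertex_mx F *m vertex_mx H = vertex_mx (fun x y => \sum_z F x z * H z y).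
Proof.
apply/matrixP => i j; rewrite !mxE -sum_vertices.
by apply: eq_bigr => k _; rewrite !mxE.
Qed.

Definition arc_mx := vertex_mx (fun x y => (x == y)%:R - (e x y)%:R).

Definition descend_mx := vertex_mx (fun x y => (connect e x y)%:R).

(** The ancestors-or-self of [y] are [y] and the ancestors-or-self of its
    parent: entrywise, [descend_mx] is the inverse of [arc_mx]. *)
Lemma sum_connect_arc x y :
  \sum_z (connect e x z)%:R * ((z == y)%:R - (e z y)%:R) = (x == y)%:R :> int.
Proof.
under eq_bigr => z _ do rewrite mulrBr.
rewrite sumrB (bigD1 y) //= eqxx mulr1 big1 ?addr0 => [|z /negPf->]; last first.
  by rewrite mulr0.
under eq_bigr => z _ do rewrite mulrC.
rewrite (sum_parents y (fun z => (connect e x z)%:R)); case: pickP => [p py | no_p].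
  rewrite (connect_parent x py); case: eqVneq => [->|_]; last by rewrite subrr.
  case yp: (connect e y p); last by rewrite subr0.
  by have := connect_height yp; rewrite leqNgt (rt_height eT py).
rewrite subr0; congr (_%:R); congr nat_of_bool.
have -> : y = r by apply/eqP/negP => /negP/(rt_parent eT)[p]; rewrite no_p.
apply/idP/eqP => [|->]; last exact: connect0.
case/connectP=> q; case/lastP: q => [//|q z]; rewrite rcons_path last_rcons.
by case/andP=> _ + rz; rewrite -rz (negPf (rt_root eT _)).
Qed.

Lemma descend_arc_mx : descend_mx *m arc_mx = 1%:M.
Proof.
rewrite vertex_mxM; apply/matrixP => i j; rewrite !mxE sum_connect_arc.
by rewrite (inj_eq enum_val_inj).
Qed.

Definition root_mx := vertex_mx (fun x y => ((x == r) && (y == r))%:R).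

(** Removing the root column from [arc_mx] leaves the oriented incidence matrix,
    whose product with its transpose is the Laplacian matrix; the root column is
    a unit vector and adds [root_mx]. *)
Lemma arc_mx_laplacian : arc_mx *m arc_mx^T = laplacian G + root_mx.
Proof.
have -> : arc_mx^T = vertex_mx (fun x y => (x == y)%:R - (e y x)%:R).
  by apply/matrixP => i j; rewrite !mxE eq_sym.
rewrite vertex_mxM; apply/matrixP => i j; rewrite !mxE.
rewrite -(inj_eq enum_val_inj); move: (enum_val i) (enum_val j) => x y.
have -> : \sum_z ((x == z)%:R - (e x z)%:R) * ((z == y)%:R - (e y z)%:R) =
   (x == y)%:R - (e y x)%:R - (e x y)%:R + \sum_z (e x z && e y z)%:R :> int.
  transitivity (\sum_z ((x == z)%:R * ((z == y)%:R - (e y z)%:R) +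
      ((e x z && e y z)%:R - (z == y)%:R * (e x z)%:R)) : int).
    by apply: eq_bigr => z _; rewrite -mulnb natrM; ring.
  rewrite big_split sumrB /= (bigD1 x) //= eqxx mul1r big1 => [|z zx]; last first.
    by rewrite eq_sym (negPf zx) mul0r.
  rewrite [\sum_i _ * _](bigD1 y) //= eqxx mul1r.
  rewrite [X in _ + (_ - (_ + X))]big1 => [|z /negPf->]; last by rewrite mul0r.
  by ring.
rewrite rooted_adjE; case: (eqVneq x y) => [<-|xy].
  rewrite rooted_degree (eq_bigr (fun z => (e x z)%:R)) => [|z _]; last first.
    by rewrite andbb.
  by case: (x == r); rewrite /= ?mulr1n; ring.
rewrite big1 => [|z _]; last first.
  case: andP => // -[xz yz].
  by rewrite (rt_parent_uniq eT xz yz) eqxx in xy.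
have -> : (x == r) && (y == r) = false.
  by apply/negP => /andP[/eqP xr /eqP yr]; rewrite xr yr eqxx in xy.
by rewrite /=; ring.
Qed.

(** Congruence by the unimodular [descend_mx] turns the Laplacian matrix into a
    diagonal matrix. *)
Lemma char_poly_rooted :
  char_poly (laplacian G) =
  \det (map_mx polyC (diag_mx (\row_i - (enum_val i != r :> G)%:R)) +
        'X *: map_mx polyC (descend_mx *m descend_mx^T)).
Proof.
have SU := descend_arc_mx; have := mulmx1C SU.
set S := descend_mx => US; have UST : arc_mx^T *m S^T = 1%:M.
  by rewrite -trmx_mul SU trmx1.
have Sr : S *m root_mx = root_mx.
  rewrite vertex_mxM; apply/matrixP => i j; rewrite !mxE (bigD1 r) //= eqxx.
  rewrite big1 ?addr0 => [|z /negPf->]; last by rewrite mulr0.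
  have := sum_connect_arc (enum_val i) r; rewrite (bigD1 r) //=.
  rewrite big1 => [|z /negPf->]; last by rewrite (negPf (rt_root eT z)) subrr mulr0.
  rewrite eqxx (negPf (rt_root eT r)) subr0 mulr1 => ->.
  by case: (enum_val i == r); rewrite ?mul1r ?mul0r.
have rS : root_mx *m S^T = root_mx.
  have rootT : root_mx^T = root_mx by apply/matrixP => i j; rewrite !mxE andbC.
  by rewrite -[LHS]trmxK trmx_mul trmxK rootT Sr rootT.
have SLS : - (S *m laplacian G *m S^T) = diag_mx (\row_i - (enum_val i != r :> G)%:R).
  have -> : laplacian G = arc_mx *m arc_mx^T - root_mx.
    by rewrite arc_mx_laplacian addrK.
  rewrite mulmxBr mulmxBl Sr rS mulmxA SU mul1mx UST.
  apply/matrixP => i j; rewrite !mxE; case: (eqVneq i j) => [<-|ij].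
    by rewrite andbb; case: (_ == r).
  have -> : (enum_val i == r) && (enum_val j == r) = false.
    apply/negP => /andP[/eqP ir /eqP jr].
    by rewrite -jr in ir; rewrite (enum_val_inj ir) eqxx in ij.
  by [].
have detS : \det (map_mx polyC S) * \det (map_mx polyC S) = 1.
  have : \det S \is a intUnitRing.unitz.
    by apply: (@intUnitRing.unitzPl _ (\det arc_mx)); rewrite -det_mulmx US det1.
  rewrite det_map_mx -rmorphM qualifE /= => /orP[]/eqP->; first by rewrite mulr1.
  by rewrite mulrNN mulr1.
rewrite /char_poly -[LHS]mulr1 -detS -[X in _ * (_ * X)]det_tr mulrCA map_trmx.
rewrite -!det_mulmx -SLS; congr (\det _); rewrite /char_poly_mx.
rewrite mulmxBl mul_scalar_mx mulmxBr -scalemxAr -!map_mxM addrC.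
by rewrite -raddfN mulmxA.
Qed.

(** The edge between [x] and its parent separates [subtree x] vertices from the
    others. *)
Definition subtree x : int := \sum_z (connect e x z)%:R.

Lemma subtree_root : subtree r = n%:R.
Proof.
rewrite /subtree (eq_bigr (fun=> 1)) => [|x _]; last by rewrite root_connect.
by rewrite sumr_const.
Qed.

(** The recursion along arcs determines the sizes of the subtrees, which are
    thus read off from any function that satisfies it. *)
Lemma subtreeP (f : G -> int) :
  (forall x, f x = 1 + \sum_y (e x y)%:R * f y) -> subtree =1 f.
Proof.
move=> f_rec x; rewrite /subtree.
transitivity (\sum_z \sum_y (connect e x z)%:R * ((z == y)%:R - (e z y)%:R) * f y).
  apply: eq_bigr => z _; under eq_bigr => y _ do rewrite -mulrA mulrBl.
  rewrite -mulr_sumr sumrB (bigD1 z) //= eqxx mul1r big1 => [|y yz]; last first.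
    by rewrite eq_sym (negPf yz) mul0r.
  by rewrite addr0 {1}f_rec addrK mulr1.
rewrite exchange_big /= (bigD1 x) //= -mulr_suml sum_connect_arc eqxx mul1r.
rewrite big1 ?addr0 // => y yx.
by rewrite -mulr_suml sum_connect_arc eq_sym (negPf yx) mul0r.
Qed.

Let K := descend_mx *m descend_mx^T.

Let KE i j : K i j =
  \sum_z (connect e (enum_val i) z)%:R * (connect e (enum_val j) z)%:R.
Proof. by rewrite !mxE -sum_vertices; apply: eq_bigr => k _; rewrite !mxE. Qed.

Let rk : 'I_n := enum_rank r.

Let enum_rk : enum_val rk = r. Proof. exact: enum_rankK. Qed.

Let Kdiag i : K i i = subtree (enum_val i).
Proof. by rewrite KE; apply: eq_bigr => z _; case: (connect _ _ _). Qed.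

Let Kroot i : K rk i = subtree (enum_val i).
Proof.
by rewrite KE; apply: eq_bigr => z _; rewrite enum_rk root_connect mul1r.
Qed.

Let Ksym i j : K i j = K j i.
Proof. by rewrite !KE; apply: eq_bigr => z _; rewrite mulrC. Qed.

Let d : 'rV[int]_n := \row_i - (enum_val i != r :> G)%:R.

Let d_root : d 0 rk = 0. Proof. by rewrite mxE enum_rk eqxx oppr0. Qed.

Let d_nonroot i : i != rk -> d 0 i = -1.
Proof. by rewrite mxE -enum_rk (inj_eq enum_val_inj) => ->. Qed.

Lemma rooted_lap_coefn : lap_coef G n = 0.
Proof.
rewrite /lap_coef subnn char_poly_rooted coef_det_pencil (big_pred1 set0) => [|S].
  by rewrite det_mix_diag0 (bigD1 rk) //= d_root mul0r mulr0.
by rewrite /= cards_eq0.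
Qed.

Lemma rooted_lap_coefn1 : lap_coef G (n - 1) = n%:R.
Proof.
have n_gt0 : (0 < n)%N := rooted_gorder_gt0.
rewrite /lap_coef subKn // char_poly_rooted coef_det_pencil.
rewrite (bigD1 [set rk]) /= ?cards1 // big1 => [|S /andP[/cards1P[i ->]]]; last first.
  rewrite (inj_eq set1_inj) => ir.
  by rewrite det_mix_diag1 (bigD1 rk) 1?eq_sym //= d_root !mul0r.
rewrite det_mix_diag1 Kroot enum_rk subtree_root addr0.
rewrite (eq_bigr _ d_nonroot) prodr_const cardC1 card_ord -subn1 mulrA.
by rewrite -exprD addnn -mul2n exprM sqrrN !expr1n mul1r.
Qed.

(** Only the minors of order two that contain the root row survive, since the
    diagonal matrix vanishes exactly at the root. For the root and [x] such a
    minor is [n * s - s * s] with [s = subtree x]. *)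
Lemma rooted_lap_coefn2 :
  (1 < n)%N -> lap_coef G (n - 2) = \sum_x subtree x * (n%:R - subtree x).
Proof.
(* Doubling passes from unordered to ordered pairs, by [sum_pairs]. *)
move=> n_gt1; apply: (@mulIf _ 2) => //; rewrite !mulr_natr.
rewrite /lap_coef subKn // char_poly_rooted coef_det_pencil -mulrnAr.
rewrite (sum_pairs (fun S => \det (mix_rows S (diag_mx d) K))).
pose Q (j : 'I_n) : int := subtree (enum_val j) * (n%:R - subtree (enum_val j)).
have detQ j : j != rk ->
    \det (mix_rows [set rk; j] (diag_mx d) K) = (-1) ^+ (n - 2) * Q j.
  move=> jr; rewrite det_mix_diag2 1?eq_sym //; congr (_ * _).
    rewrite (eq_bigr (fun=> -1)) => [|k]; last first.
      by rewrite !inE negb_or => /andP[/d_nonroot-> _].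
    rewrite prodr_const; congr (_ ^+ _).
    by rewrite cardsCs setCK cards2 (eq_sym rk) jr card_ord.
  by rewrite (Ksym j rk) !Kroot Kdiag enum_rk subtree_root /Q; ring.
have Q_root : Q rk = 0 by rewrite /Q enum_rk subtree_root subrr mulr0.
have -> : \sum_i \sum_(j | j != i) \det (mix_rows [set i; j] (diag_mx d) K) =
    (-1) ^+ (n - 2) * (\sum_i Q i) *+ 2.
  rewrite [in RHS](bigD1 rk) //= Q_root add0r mulr2n mulr_sumr.
  rewrite (bigD1 rk) //=; congr (_ + _); first by apply: eq_bigr => j /detQ.
  apply: eq_bigr => i ir; rewrite (bigD1 rk) 1?eq_sym //= setUC detQ //.
  rewrite big1 ?addr0 // => j /andP[ji jr].
  rewrite det_mix_diag2 1?eq_sym // (bigD1 rk) /= ?d_root ?mul0r //.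
  by rewrite !inE negb_or eq_sym ir eq_sym jr.
rewrite -mulrnAr mulrA -exprD addnn -mul2n exprM sqrrN !expr1n mul1r.
by rewrite -sum_vertices.
Qed.

End RootedTree.

(** * Starlike trees *)

Lemma sum_option (R : nmodType) (V : finType) (F : option V -> R) :
  \sum_x F x = F None + \sum_v F (Some v).
Proof.
rewrite (bigD1 None) //=; congr (_ + _).
rewrite (reindex_omap Some id) => [|[]//] /=.
by apply: eq_bigl => v; rewrite eqxx.
Qed.

Lemma sum_ord_eq n k (F : nat -> int) :
  \sum_(j < n) (j == k :> nat)%:R * F j = if (k < n)%N then F k else 0.
Proof.
rewrite -(big_ord1_eq +%R) [RHS]big_mkcond /=; apply: eq_bigr => j _.
by case: eqP => _; rewrite ?mul1r ?mul0r.
Qed.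

Lemma card_ord_eq n k : \sum_(j < n) (j == k :> nat)%:R = (k < n)%:R :> int.
Proof.
transitivity (\sum_(j < n) (j == k :> nat)%:R * 1 : int).
  by apply: eq_bigr => j _; rewrite mulr1.
by rewrite (sum_ord_eq n k (fun=> 1)); case: ltnP.
Qed.

Section Starlike.

Variables n1 n2 n3 : nat.

Lemma sum_starlike (F : starlike n1 n2 n3 -> int) :
  \sum_x F x = F None + (\sum_(i < n1) F (Some (inl (inl i)))
    + \sum_(i < n2) F (Some (inl (inr i))) + \sum_(i < n3) F (Some (inr i))).
Proof. by rewrite [LHS]sum_option !big_sumType. Qed.

Lemma starlike_order : gorder (starlike n1 n2 n3) = (n1 + n2 + n3).+1.
Proof. by rewrite /gorder card_option !card_sum !card_ord. Qed.

Definition starlike_height (x : starlike n1 n2 n3) : nat :=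
  match x with
  | None => 0
  | Some (inl (inl i)) | Some (inl (inr i)) | Some (inr i) => i.+1
  end.

Lemma starlike_rooted :
  rooted_tree (@starlike_arc n1 n2 n3 : rel (starlike n1 n2 n3)) None
    starlike_height.
Proof.
split=> //.
- by move=> [[[i|i]|i]|] [[[j|j]|j]|] //= => /eqP->.
- move=> [[[i|i]|i]|] [[[j|j]|j]|] [[[k|k]|k]|] //= /eqP-> //;
    by rewrite // eqSS => /eqP/val_inj->.
- by move=> [[[i|i]|i]|].
- have pred_lt k (i : 'I_k) : (i.-1 < k)%N by apply: leq_ltn_trans (leq_pred i) _.
  move=> [[[i|i]|i]|] //= _; case: (posnP i) => i0; try by exists None; rewrite /= i0.
  + by exists (Some (inl (inl (Ordinal (pred_lt _ i))))); rewrite /= prednK.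
  + by exists (Some (inl (inr (Ordinal (pred_lt _ i))))); rewrite /= prednK.
  + by exists (Some (inr (Ordinal (pred_lt _ i)))); rewrite /= prednK.
Qed.

Definition starlike_subtree (x : starlike n1 n2 n3) : int :=
  match x with
  | None => (n1 + n2 + n3).+1%:R
  | Some (inl (inl i)) => n1%:R - i%:R
  | Some (inl (inr i)) => n2%:R - i%:R
  | Some (inr i) => n3%:R - i%:R
  end.

Lemma subtree_starlike :
  subtree (@starlike_arc n1 n2 n3 : rel (starlike n1 n2 n3)) =1 starlike_subtree.
Proof.
have sum0 n (F : 'I_n -> int) : \sum_(i < n) 0%:R * F i = 0.
  by rewrite big1 // => i _; rewrite mul0r.
have sumS n k : \sum_(j < n) (j == k :> nat)%:R * (n%:R - j%:R) =
    if (k < n)%N then n%:R - k%:R else 0 :> int.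
  exact: (sum_ord_eq n k (fun j => n%:R - j%:R)).
have last_arm n (i : 'I_n) :
    n%:R - i%:R = 1 + (if (i.+1 < n)%N then n%:R - i.+1%:R else 0) :> int.
  by rewrite !natz; case: (ltnP i.+1); have := ltn_ord i; lia.
apply: (subtreeP starlike_rooted) => x; rewrite sum_starlike.
case: x => [[[i|i]|i]|] /=; rewrite ?sum0 ?sumS ?last_arm ?mul0r ?add0r ?addr0 //.
have pos_or0 k : (if (0 < k)%N then k%:R else 0) = k%:R :> int by case: k.
by rewrite !pos_or0 -natr1 !natrD addrC.
Qed.

Lemma starlike_branching :
  (0 < n1)%N -> (0 < n2)%N -> (0 < n3)%N ->
  \sum_(x : starlike n1 n2 n3) ((degree x)%:R - 1) * ((degree x)%:R - 2) = 2 :> int.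
Proof.
have sum0 n : \sum_(i < n) 0%:R = 0 :> int by rewrite big1.
move=> n1_gt0 n2_gt0 n3_gt0.
rewrite sum_starlike ?(rooted_degree starlike_rooted) !sum_starlike /=.
rewrite !card_ord_eq n1_gt0 n2_gt0 n3_gt0.
rewrite !big1 // => i _; rewrite (rooted_degree starlike_rooted) sum_starlike /=;
  by rewrite !sum0 card_ord_eq; case: ltnP.
Qed.

(** The arm with [n] edges contributes k(N - k) for k = n, ..., 1 to the Wiener
    index of a tree of order N = c + n. *)
Lemma sum_arm (n : nat) (c : int) :
  (\sum_(i < n) (n%:R - i%:R) * (c + i%:R)) * 6 =
  n%:R * (n%:R + 1) * (c * 3 + n%:R - 1) :> int.
Proof.
elim: n c => [|n IHn] c; first by rewrite big_ord0 !mul0r.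
rewrite big_ord_recl mulrDl /=.
rewrite (eq_bigr (fun i : 'I_n => (n%:R - i%:R) * ((c + 1) + i%:R))) => [|i _].
  by rewrite IHn -natr1; ring.
by rewrite /= /bump /= add1n -!natr1; ring.
Qed.

Lemma starlike_wiener : let n := (n1 + n2 + n3).+1 in (1 < n)%N ->
  lap_coef (starlike n1 n2 n3) (n - 2) * 6 =
    n1%:R * (n1%:R + 1) * (n%:R * 3 - n1%:R * 2 - 1)
  + n2%:R * (n2%:R + 1) * (n%:R * 3 - n2%:R * 2 - 1)
  + n3%:R * (n3%:R + 1) * (n%:R * 3 - n3%:R * 2 - 1).
Proof.
move=> n n_gt1; have := rooted_lap_coefn2 starlike_rooted.
rewrite starlike_order -/n => -> //; rewrite sum_starlike !subtree_starlike /=.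
rewrite -/n subrr mulr0 add0r !mulrDl.
have arm k : (\sum_(i < k) (k%:R - i%:R) * (n%:R - (k%:R - i%:R))) * 6 =
    k%:R * (k%:R + 1) * (n%:R * 3 - k%:R * 2 - 1) :> int.
  rewrite (eq_bigr (fun i : 'I_k => (k%:R - i%:R) * ((n%:R - k%:R) + i%:R))).
    by rewrite sum_arm; ring.
  by move=> i _; ring.
by rewrite -!arm; congr (_ * _ + _ * _ + _ * _); apply: eq_bigr => i _;
  rewrite subtree_starlike.
Qed.

End Starlike.

(** * Paths with two pendent vertices *)

Section PathPendent.

Variables m p q : nat.
Hypotheses (p_lt : (p < m)%N) (q_lt : (q < m)%N).

Lemma sum_path_pendent2 (F : path_pendent2 m p q -> int) :
  \sum_x F x = \sum_(i < m) F (inl i) + (F (inr false) + F (inr true)).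
Proof. by rewrite [LHS]big_sumType big_bool [F _ + _]addrC. Qed.

Lemma path_pendent2_order : gorder (path_pendent2 m p q) = m.+2.
Proof. by rewrite /gorder card_sum card_ord card_bool addn2. Qed.

Let root : path_pendent2 m p q := inl (Ordinal (leq_ltn_trans (leq0n p) p_lt)).

Definition path_pendent2_height (x : path_pendent2 m p q) : nat :=
  if x is inl i then i else m.

Lemma path_pendent2_rooted :
  rooted_tree (@pendent2_arc m p q : rel (path_pendent2 m p q)) root
    path_pendent2_height.
Proof.
split=> //.
- by move=> [i|b] [j|c] //= /eqP->.
- move=> [i|b] [j|c] [k|a] //=; first by move=> /eqP-> /eqP[/val_inj->].
  by move=> /eqP ip /eqP jp; congr inl; apply: val_inj; rewrite /= ip.
- by move=> [i|b].
- move=> [i|b] /= root_i.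
    have i_gt0 : (0 < i)%N.
      rewrite lt0n; apply: contraNneq root_i => i0.
      by apply/eqP; congr inl; apply: val_inj.
    have i_lt : (i.-1 < m)%N by apply: leq_ltn_trans (leq_pred i) _.
    by exists (inl (Ordinal i_lt)); rewrite /= prednK.
  case: b root_i => _; first by exists (inl (Ordinal q_lt)) => /=.
  by exists (inl (Ordinal p_lt)) => /=.
Qed.

(** Seen from [v_0], a pendent vertex descends from the path vertices up to the
    one that it is attached to. *)
Definition path_pendent2_subtree (x : path_pendent2 m p q) : int :=
  if x is inl i then m%:R - i%:R + (i <= p)%:R + (i <= q)%:R else 1.

Lemma subtree_path_pendent2 :
  subtree (@pendent2_arc m p q : rel (path_pendent2 m p q)) =1
  path_pendent2_subtree.
Proof.
apply: (subtreeP path_pendent2_rooted) => x; rewrite sum_path_pendent2.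
case: x => [i|b] /=; last first.
  by rewrite big1 => [|i _]; rewrite ?mul0r.
rewrite (sum_ord_eq m i.+1 (fun j => m%:R - j%:R + (j <= p)%:R + (j <= q)%:R)).
have := ltn_ord i; move: (val i) => {}i i_lt; rewrite !natz.
by case: (ltnP i.+1); lia.
Qed.

Lemma path_pendent2_branching :
  (0 < p < m.-1)%N -> (0 < q < m.-1)%N -> p != q ->
  \sum_(x : path_pendent2 m p q) ((degree x)%:R - 1) * ((degree x)%:R - 2) = 4
  :> int.
Proof.
move=> /andP[p_gt0 p_last] /andP[q_gt0 q_last] pq.
have deg_inr b : (degree (inr b : path_pendent2 m p q))%:R = 1 :> int.
  by rewrite (rooted_degree path_pendent2_rooted) sum_path_pendent2 /= big1.
rewrite sum_path_pendent2 !deg_inr.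
have -> : (1 - 1) * (1 - 2) + (1 - 1) * (1 - 2) = 0 :> int by [].
rewrite addr0.
transitivity (\sum_(i < m) ((i == p :> nat)%:R * 2 + (i == q :> nat)%:R * 2) : int).
  apply: eq_bigr => i _.
  rewrite (rooted_degree path_pendent2_rooted) sum_path_pendent2 /= card_ord_eq.
  have -> : (inl i != root) = (0 < i)%N by rewrite lt0n.
  have := ltn_ord i; move: (val i) => {}i i_lt.
  case: (ltnP i.+1); case: (posnP i); case: (eqVneq i p); case: (eqVneq i q);
    by rewrite /= ; lia.
rewrite big_split /= -!mulr_suml !card_ord_eq p_lt q_lt.
by [].
Qed.

End PathPendent.

(** The inner vertices contribute like an arm with [k.+3] edges in a tree of order
    [k.+2.+4], except for the last two vertices of that arm; the sum over the arm
    is therefore [sum_arm k.+3 3]. *)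
Lemma path_pendent2_wiener k :
  lap_coef (path_pendent2 k.+4 1 k.+2) k.+4 * 6 =
    (k%:R + 3) * (k%:R + 4) * (k%:R + 11) + (k%:R + 7) * 6.
Proof.
have q_lt : (k.+2 < k.+4)%N by [].
have := rooted_lap_coefn2 (path_pendent2_rooted (isT : (1 < k.+4)%N) q_lt).
rewrite path_pendent2_order => -> //.
rewrite sum_path_pendent2 !subtree_path_pendent2 //=.
pose s (i : nat) : int := k.+4%:R - i%:R + (i <= 1)%:R + (i <= k.+2)%:R.
rewrite (eq_bigr (fun i : 'I_k.+4 => s i * (k.+2.+4%:R - s i))) => [|i _]; last first.
  by rewrite subtree_path_pendent2.
rewrite 2!big_ord_recl big_ord_recr /= /bump /= !add1n.
have := sum_arm k.+3 3; rewrite 2!big_ord_recr /=.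
rewrite (eq_bigr (fun i : 'I_k.+1 => s i.+2 * (k.+2.+4%:R - s i.+2)));
  last first => [i _|].
  have -> : s i.+2 = k.+3%:R - i%:R.
    by rewrite /s !natz; have := ltn_ord i; lia.
  by rewrite !natz; lia.
set sigma := bigop _ _ _.
have -> : s 0%N = k%:R + 6 by rewrite /s /= !natz; lia.
have -> : s 1%N = k%:R + 5 by rewrite /s /= !natz; lia.
have -> : s k.+3 = 1 by rewrite /s /= ltnn !natz; lia.
by rewrite !natz; lia.
Qed.

(** * Comparison of the two trees *)

Theorem mainTheorem7 (n : nat) (hn : (7 < n)%N) :
  let T1 := starlike (n - 5) 2 2 in
  let T2 := path_pendent2 (n - 2) 1 (n - 4) in
  [/\ is_tree T1 /\ gorder T1 = n,
      is_tree T2 /\ gorder T2 = n,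
      prec1 T2 T1
    & prec2 T1 T2].
Proof.
move=> T1 T2.
have [p_lt q_lt] : (1 < n - 2 /\ n - 4 < n - 2)%N by lia.
have rT1 := starlike_rooted (n - 5) 2 2.
have rT2 := path_pendent2_rooted p_lt q_lt.
have oT1 : gorder T1 = n by rewrite starlike_order; lia.
have oT2 : gorder T2 = n by rewrite path_pendent2_order; lia.
have coef1 : lap_coef T1 1 = lap_coef T2 1.
  by rewrite (rooted_lap_coef1 rT1) (rooted_lap_coef1 rT2) oT1 oT2.
have coefn : lap_coef T1 n = lap_coef T2 n.
  by rewrite -{1}oT1 -oT2 (rooted_lap_coefn rT1) (rooted_lap_coefn rT2).
have coefn1 : lap_coef T1 (n - 1) = lap_coef T2 (n - 1).
  by rewrite -{1}oT1 -oT2 (rooted_lap_coefn1 rT1) (rooted_lap_coefn1 rT2) oT1 oT2.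
have coef2 : lap_coef T2 2 < lap_coef T1 2.
  have n_gt1 : (1 < n)%N by lia.
  have := rooted_lap_coef2 rT1; have := rooted_lap_coef2 rT2.
  rewrite oT1 oT2 => /(_ n_gt1) + /(_ n_gt1).
  rewrite starlike_branching //; last by lia.
  rewrite path_pendent2_branching //; try lia.
  rewrite -/T1 -/T2 !mulr2n; lia.
have coefn2 : lap_coef T1 (n - 2) < lap_coef T2 (n - 2).
  (* With n = k + 6, six times the difference is the polynomial 12 (k - 1). *)
  have [k nk] : exists k, n = k.+2.+4 by exists (n - 6)%N; lia.
  clear -nk hn; subst n T1 T2.
  have w1 := @starlike_wiener k.+1 2 2 isT; rewrite !addn2 in w1.
  have {}w1 : lap_coef (starlike k.+1 2 2) k.+4 * 6 = _ := w1.
  have w2 : lap_coef (path_pendent2 k.+4 1 k.+2) k.+4 * 6 = _ := path_pendent2_wiener k.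
  change (lap_coef (starlike k.+1 2 2) k.+4 <
          lap_coef (path_pendent2 k.+4 1 k.+2) k.+4).
  rewrite !natz in w1 w2.
  lia.
split.
- by split=> //; apply: rooted_is_tree rT1.
- by split=> //; apply: rooted_is_tree rT2.
- exists 2; split=> //.
  + by split; [rewrite oT2; lia | apply/eqP; rewrite lt_eqF].
  + move=> [|[|k]] [_ differ] //; first by case: differ; rewrite !lap_coef0.
    by case: differ; rewrite coef1.
- exists (n - 2)%N; split=> //.
  + by split; [rewrite oT1; lia | apply/eqP; rewrite lt_eqF].
  + move=> k [k_le differ]; rewrite oT1 in k_le.
    rewrite leqNgt; apply/negP => k_gt.
    have /orP[/eqP kn | /eqP kn] : (k == n) || (k == n - 1)%N by lia.
      by rewrite kn in differ.
    by rewrite kn in differ.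
Qed.
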